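(* Let $X$ be a regular $P$-space with at least two points. The following statements are equivalent. (1) $\mathscr{F}[X]$ is SHD. (2) $\mathscr{F}[X]$ is WSHD. (3) $\mathscr{F}[X]$ is OHD. (4) $\mathscr{F}[X]$ is UC. (5) $\mathscr{F}[X]$ is $\pi$-UC. (6) $X$ is SHD. (7) $X$ is WSHD. (8) $X$ is OHD. (9) $X$ is UC. (10) $X$ is $\pi$-UC.
   Context: Regular spaces are understood to be $T_1$ (as in Engelking's book). A space is a $P$-space if every countable intersection of open sets is open. The Pixley-Roy hyperspace $\mathscr{F}[X]$ is the set of all non-empty finite subsets of $X$ with the topology having as a base all sets $[F,U]=\{G\in\mathscr{F}[X] : F\subseteq G\subseteq U\}$, where $F\in\mathscr{F}[X]$ and $U\subseteq X$ is open. Let $Y$ be a topological space. - $Y$ is SHD if for every sequence $(U_n)_{n\in\omega}$ of non-empty open subsets of $Y$ one can pick $x_n\in U_n$ for each $n\in\omega$ so that $(x_n)$ has no convergent subsequence. - $Y$ is WSHD if for every sequence $(U_n)_{n\in\omega}$ of non-empty open subsets of $Y$ there are an infinite $A\subseteq\omega$ and points $x_n\in U_n$ for $n\in A$ such that $(x_n)_{n\in A}$ has no convergent subsequence. - A sequence $(U_n)_{n\in\omega}$ of non-empty open sets converges to $y\in Y$ if for every open $U\ni y$ there is $m\in\omega$ with $U_n\subseteq U$ for all $n\geq m$. $Y$ is OHD if no sequence of non-empty open subsets of $Y$ converges to a point of $Y$. - A local $\pi$-basis for $y\in Y$ is a family $\mathscr{B}$ of non-empty open sets such that every open $U\ni y$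 contains some $B\in\mathscr{B}$; it is a local base if moreover $y\in\bigcap\mathscr{B}$. $\chi(y,Y)$ (resp. $\pi\chi(y,Y)$) is the least cardinality of a local base (resp. local $\pi$-basis) for $y$ in $Y$. $Y$ is UC (resp. $\pi$-UC) if $\chi(y,Y)>\omega$ (resp. $\pi\chi(y,Y)>\omega$) for every $y\in Y$. *)

(* Defs.v *)
From HB Require Import structures.
From mathcomp Require Import all_boot finmap all_classical topology.

Set Implicit Arguments.
Unset Strict Implicit.
Unset Printing Implicit Defensive.

Local Open Scope classical_set_scope.
Local Open Scope card_scope.

Section LeastCardinality.
Context {T : Type}.

(* Cardinals are represented by sets, compared by [#<=]: [least_card P] is a
   member of [P] of least cardinality (see [least_cardP] for existence). *)
Definition least_card (P : set (set T)) : set T :=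
  xget set0 [set A | P A /\ forall B, P B -> A #<= B].

Lemma least_card_ex (P : set (set T)) : P !=set0 ->
  exists A, P A /\ forall B, P B -> A #<= B.
Proof.
move=> [A0 PA0].
have [A00|/set0P[t0 _]] := eqVneq A0 set0.
  by exists A0; split=> // B _; rewrite A00; exact: card_ge0.
pose good (S : set (set T -> T)) :=
  (forall f B, S f -> P B -> B (f B)) /\
  (forall f g B, S f -> S g -> P B -> f B = g B -> f = g).
have [S [[Sin Sinj] Smax]] : exists S, good S /\ forall S', S `<` S' -> ~ good S'.
  apply: Zorn_bigcup => F Fgood Ftot; split.
    by move=> f B [S FS Sf] PB; have [h _] := Fgood _ FS; apply: (h f B).
  move=> f g B [S1 FS1 S1f] [S2 FS2 S2g] PB.
  have [S12|S21] := Ftot _ _ FS1 FS2.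
    by have [_ h] := Fgood _ FS2; apply: h => //; exact: S12.
  by have [_ h] := Fgood _ FS1; apply: h => //; exact: S21.
have [[B [PB BS]]|nB] :=
    pselect (exists B, P B /\ B `<=` (fun f : set T -> T => f B) @` S).
  exists B; split=> // C PC.
  apply: card_le_trans (subset_card_le BS) _.
  apply: card_le_trans (card_image_le _ _) _.
  have -> : (S #<= C) = ((fun f : set T -> T => f C) @` S #<= C).
    apply: card_le_eql; rewrite card_eq_sym; apply: inj_card_eq => f g.
    by rewrite !inE => Sf Sg; exact: (Sinj f g C).
  by apply: subset_card_le => _ [f Sf <-]; exact: (Sin f C).
have hP B : exists t, P B -> B t /\ forall f, S f -> f B <> t.
  have [PB|nPB] := pselect (P B); last by exists t0.
  apply: contrapT => nt; apply: nB; exists B; split=> // t Bt.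
  apply: contrapT => nSt; apply: nt; exists t => _; split=> // f Sf fBt.
  by apply: nSt; exists f.
have [h hh] := choice hP.
exfalso; apply: (Smax (h |` S)).
  split; first exact: subsetUr.
  move=> sub; have [_ /(_ h)] := hh _ PA0; apply=> //.
  by apply: sub; left.
split=> [f B [->|Sf] PB|f g B].
- by have [] := hh _ PB.
- exact: (Sin f B).
- move=> [->|Sf] [->|Sg] PB // e.
  + by have [_ /(_ g Sg)] := hh _ PB; rewrite e.
  + by have [_ /(_ f Sf)] := hh _ PB; rewrite e.
  + exact: (Sinj f g B).
Qed.

Lemma least_cardP (P : set (set T)) : P !=set0 ->
  P (least_card P) /\ forall B, P B -> least_card P #<= B.
Proof.
by move=> /least_card_ex[A PA]; rewrite /least_card; case: xgetP => // /(_ A).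
Qed.

End LeastCardinality.

Section Properties.
Variable Y : topologicalType.
Implicit Types (y : Y) (A : set nat) (x : nat -> Y) (U : nat -> set Y)
  (B : set (set Y)).

Definition p_space :=
  forall U, (forall n, open (U n)) -> open (\bigcap_n U n).

Definition nonempty_open_seq U := forall n, open (U n) /\ U n !=set0.

(* The sequence [x] is only looked at on the infinite index set [A]. *)
Definition has_cvg_subseq A x :=
  exists (s : nat -> nat) (l : Y),
    [/\ {homo s : m n / (m < n)%N}, forall k, A (s k) & x \o s @ \oo --> l].

Definition SHD := forall U, nonempty_open_seq U ->
  exists2 x, (forall n, U n (x n)) & ~ has_cvg_subseq [set: nat] x.

Definition WSHD := forall U, nonempty_open_seq U ->
  exists A x, [/\ infinite_set A, forall n, A n -> U n (x n) &
    ~ has_cvg_subseq A x].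

Definition set_seq_cvg U y :=
  forall V, open V -> V y -> exists m, forall n, (m <= n)%N -> U n `<=` V.

Definition OHD :=
  ~ exists U y, nonempty_open_seq U /\ set_seq_cvg U y.

Definition local_pi_basis y B :=
  (forall V, B V -> open V /\ V !=set0) /\
  (forall O : set Y, open O -> O y -> exists2 V, B V & V `<=` O).

Definition local_base y B := local_pi_basis y B /\ (\bigcap_(V in B) V) y.

Lemma local_base_ex y : local_base y !=set0.
Proof.
exists (open_nbhs y); split; last by move=> V [].
split=> [V [oV Vy]|O oO Oy]; first by split=> //; exists y.
by exists O.
Qed.

Lemma local_pi_basis_ex y : local_pi_basis y !=set0.
Proof. by have [B [? _]] := local_base_ex y; exists B. Qed.

Definition character y : set (set Y) := least_card (local_base y).

Definition pi_character y : set (set Y) := least_card (local_pi_basis y).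

Definition UC := forall y, ~ countable (character y).

Definition pi_UC := forall y, ~ countable (pi_character y).

End Properties.

Definition pixley_roy (X : topologicalType) : Type :=
  {F : {fset X} | F != fset0}.

Section PixleyRoy.
Variable X : topologicalType.

HB.instance Definition _ := Choice.on (pixley_roy X).

Definition pr_interval (F : pixley_roy X) (U : set X) : set (pixley_roy X) :=
  [set G | [set` val F] `<=` [set` val G] /\ [set` val G] `<=` U].

Definition pr_base : set (set (pixley_roy X)) :=
  [set W | exists F U, open U /\ W = pr_interval F U].

Let pr_base_cover : \bigcup_(W in pr_base) id W = setT.
Proof.
rewrite -subTset => F _; exists (pr_interval F setT); last by split.
by exists F, setT; split=> //; exact: openT.
Qed.

Let pr_base_join W1 W2 G : pr_base W1 -> pr_base W2 -> id W1 G -> id W2 G ->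
  exists W, [/\ pr_base W, id W G & id W `<=` id W1 `&` id W2].
Proof.
move=> [F1 [U1 [oU1 ->]]] [F2 [U2 [oU2 ->]]] [F1G GU1] [F2G GU2].
exists (pr_interval G (U1 `&` U2)); split.
- by exists G, (U1 `&` U2); split=> //; exact: openI.
- by split=> // t Gt; split; [exact: GU1|exact: GU2].
- move=> H [GH HU]; split; split.
  + exact: subset_trans GH.
  + by move=> t /HU[].
  + exact: subset_trans GH.
  + by move=> t /HU[].
Qed.

HB.instance Definition _ := @isBaseTopological.Build (pixley_roy X)
  (set (pixley_roy X)) pr_base id pr_base_cover pr_base_join.

Lemma pr_openE (A : set (pixley_roy X)) :
  open A <-> exists2 D, D `<=` pr_base & \bigcup_(W in D) W = A.
Proof. by []. Qed.

End PixleyRoy.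

(* Main.v *)
(* Call a space crowded when it has no isolated point. In a T1 P-space a
   countable set avoiding [y] is closed, so [y] has a neighbourhood missing it.
   Hence a countable local pi-basis at [y] forces [y] to be isolated, and a
   sequence of distinct points has no convergent subsequence; each of the five
   properties is therefore equivalent to being crowded. The Pixley-Roy
   hyperspace of a T1 P-space is again a T1 P-space, and it is crowded exactly
   when the underlying space is. *)
Require Import Defs.
From mathcomp Require Import all_boot finmap all_classical topology.

Set Implicit Arguments.
Unset Strict Implicit.
Unset Printing Implicit Defensive.

Local Open Scope classical_set_scope.
Local Open Scope card_scope.

(** * Isolated points *)

Definition crowded (Y : topologicalType) := forall y : Y, ~ open [set y].

Lemma accessible_open_setC1 (Y : topologicalType) (y : Y) :
  accessible_space Y -> open (~` [set y]).
Proof. by move=> Y_T1; rewrite openC; exact: accessible_closed_set1. Qed.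

Lemma not_isolated_other_point (Y : topologicalType) (V : set Y) (y : Y) :
  ~ open [set y] -> open V -> V y -> exists2 z, V z & z <> y.
Proof.
move=> y_nisol oV Vy; apply: contrapT => noz; apply: y_nisol.
suff <- : V = [set y] by [].
apply/seteqP; split=> [z Vz|_ -> //].
by apply: contrapT => zy; apply: noz; exists z.
Qed.

Lemma open_isolated_local_base (Y : topologicalType) (y : Y) :
  open [set y] -> local_base y [set [set y]].
Proof.
move=> oy; split; last by move=> _ ->.
split=> [_ ->|O oO Oy]; first by split=> //; exists y.
by exists [set y] => // _ ->.
Qed.

(** * Countable sets and sequences in T1 P-spaces *)

Section T1PSpace.
Variable Y : topologicalType.
Hypotheses (Y_T1 : accessible_space Y) (Y_P : p_space Y).

(** Removing the single point [x n], when it differs from [y], leaves an open set by T1; the P-space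
    property allows doing so for all [n] at once. *)
Lemma p_space_avoid_seq (x : nat -> Y) (y : Y) :
  exists O : set Y, [/\ open O, O y & forall n, O (x n) -> x n = y].
Proof.
exists (\bigcap_n [set z | z = x n -> x n = y]); split=> [|n _ /= -> //|n].
- apply: Y_P => n; have [xny|xny] := pselect (x n = y).
    rewrite (_ : [set _ | _] = setT); first exact: openT.
    by apply/seteqP; split=> z _ //= _.
  rewrite (_ : [set _ | _] = ~` [set x n]); first exact: accessible_open_setC1.
  by apply/seteqP; split=> z /= h // /h.
- by move=> /(_ n I) /= ->.
Qed.

(** Otherwise every member of [B] contains a point other than [y], and a neighbourhood of [y]
    avoiding these countably many points contains no member of [B]. *)
Lemma countable_local_pi_basis_isolated (y : Y) (B : set (set Y)) :
  countable B -> local_pi_basis y B -> open [set y].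
Proof.
move=> /countable_injP[f f_inj] [B_open B_small].
apply: contrapT => y_nisol.
have other V : B V -> exists2 z, V z & z <> y.
  move=> BV; have [oV [z Vz]] := B_open _ BV.
  have [zy|] := pselect (z = y); last by exists z.
  by apply: not_isolated_other_point => //; rewrite -zy.
have /choice[x xP] n : exists x, forall V, B V -> f V = n -> V x /\ x <> y.
  have [[V [BV fVn]]|noV] := pselect (exists V, B V /\ f V = n); last first.
    by exists y => V BV fVn; case: noV; exists V.
  have [z Vz zy] := other _ BV; exists z => W BW fWn.
  by rewrite (f_inj W V) ?inE ?fVn.
have [O [oO Oy Ox]] := p_space_avoid_seq x y.
have [V BV VO] := B_small _ oO Oy.
have [Vx xy] := xP _ _ BV erefl.
by apply: xy; apply: Ox; exact: VO.
Qed.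

Lemma crowded_avoid_finite (V : set Y) (s : seq Y) :
  crowded Y -> open V -> V !=set0 -> exists2 z, V z & z \notin s.
Proof.
move=> Y_crowded oV [y Vy].
(* The list is turned into a sequence by padding with [y], so [O] meets [s] at most in [y]. *)
have [O [oO Oy Os]] := p_space_avoid_seq (nth y s) y.
have [z [Vz Oz] zy] :=
  not_isolated_other_point (@Y_crowded y) (openI oV oO) (conj Vy Oy).
exists z => //; apply/negP => zs; apply: zy.
by have := Os (index z s); rewrite nth_index //; apply.
Qed.

(** Some neighbourhood of a limit [l] contains no term other than [l], so a convergent subsequence
    would be eventually constant. *)
Lemma injective_no_cvg_subseq (A : set nat) (x : nat -> Y) :
  injective x -> ~ has_cvg_subseq A x.
Proof.
move=> x_inj [s [l [s_incr _ xs_l]]].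
have [O [oO Ol Ox]] := p_space_avoid_seq x l.
have [N _ hN] := xs_l _ (open_nbhs_nbhs (conj oO Ol)).
have xl k : (N <= k)%N -> x (s k) = l by move=> Nk; apply: Ox; exact: hN.
have /x_inj sN : x (s N) = x (s N.+1) by rewrite !xl.
by have := s_incr _ _ (ltnSn N); rewrite -sN ltnn.
Qed.

Lemma crowded_SHD : crowded Y -> SHD Y.
Proof.
move=> Y_crowded U U_open.
have /choice[pick pickP] (p : seq Y * nat) :
    exists z, U p.2 z /\ z \notin p.1.
  have [oU U0] := U_open p.2.
  by have [z] := crowded_avoid_finite p.1 Y_crowded oU U0; exists z.
(* [hist n] lists the points chosen before stage [n], latest first; picking outside it makes [x]
   injective. *)
pose hist := fix hist n := if n is m.+1 then pick (hist m, m) :: hist m else [::].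
pose x n := pick (hist n, n).
have x_hist m n : (m < n)%N -> x m \in hist n.
  elim: n => // n IHn; rewrite ltnS leq_eqVlt inE => /orP[/eqP-> |/IHn->].
    by rewrite eqxx.
  by rewrite orbT.
have x_lt m n : (m < n)%N -> x m <> x n.
  move=> /x_hist xm xmn; have [_ /negP] := pickP (hist n, n).
  by apply; rewrite -/(x n) -xmn.
exists x => [n|]; first by have [] := pickP (hist n, n).
apply: injective_no_cvg_subseq => m n xmn.
by case: (ltngtP m n) => // /x_lt; [move/(_ xmn)|move/(_ (esym xmn))].
Qed.

End T1PSpace.

(** * Equivalence of the five properties with crowdedness *)

Lemma infinite_set_nat_subseq (A : set nat) : infinite_set A ->
  exists2 s : nat -> nat, {homo s : m n / (m < n)%N} & forall k, A (s k).
Proof.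
move=> A_inf.
have /choice[next nextP] n : exists m, A m /\ (n < m)%N.
  apply: contrapT => nom; apply: A_inf.
  apply: (@sub_finite_set _ _ `I_n.+1); last exact: finite_II.
  by move=> m Am /=; rewrite ltnS leqNgt; apply/negP => nm; apply: nom; exists m.
(* The iteration count starts at 1 because 0 itself need not lie in [A]. *)
exists (fun k => iter k.+1 next 0) => [|k]; last by have [] := nextP (iter k next 0).
by apply: homo_ltn => [? ? ?|k]; [exact: ltn_trans|have [] := nextP (iter k.+1 next 0)].
Qed.

(** In any space, points selected from a convergent sequence of sets converge to the same limit,
    along every infinite index set. *)
Lemma WSHD_OHD (Y : topologicalType) : WSHD Y -> OHD Y.
Proof.
move=> Y_WSHD [U [y [U_open U_y]]].
have [A [x [/infinite_set_nat_subseq[s s_incr As] xU]]] := Y_WSHD U U_open.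
apply; exists s, y; split=> // V; rewrite nbhsE => -[W [oW Wy] WV].
have [m Um] := U_y W oW Wy.
exists m => // k /= mk; apply/WV/(Um (s k)); last exact/xU/As.
(* A strictly increasing [s] satisfies [k <= s k]. *)
apply: leq_trans mk _; elim: k => // k IHk.
exact: leq_ltn_trans IHk (s_incr _ _ (ltnSn k)).
Qed.

Lemma T1_p_space_crowded_tfae (Y : topologicalType) :
  accessible_space Y -> p_space Y ->
  [<-> SHD Y; WSHD Y; OHD Y; UC Y; pi_UC Y; crowded Y].
Proof.
move=> Y_T1 Y_P; tfae.
- move=> Y_SHD U U_open; have [x xU xcvg] := Y_SHD U U_open.
  by exists setT, x; split=> //; exact: infinite_nat.
- exact: WSHD_OHD.
(* A point of countable character is isolated, and its singleton, repeated, is a sequence of open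
   sets converging to it. *)
- move=> Y_OHD y y_cnt; apply: Y_OHD.
  have [[y_base _] _] := least_cardP (local_base_ex y).
  have oy := countable_local_pi_basis_isolated Y_T1 Y_P y_cnt y_base.
  exists (fun=> [set y]), y; split=> [n|V _ Vy]; first by split=> //; exists y.
  by exists 0 => n _ _ ->.
(* Countable pi-character already isolates [y], whose singleton then forms a one-element local
   base. *)
- move=> Y_UC y y_cnt; apply: (Y_UC y).
  have [y_base _] := least_cardP (local_pi_basis_ex y).
  have oy := countable_local_pi_basis_isolated Y_T1 Y_P y_cnt y_base.
  have [_ y_least] := least_cardP (local_base_ex y).
  apply: card_le_trans (y_least _ (open_isolated_local_base oy)) _.
  exact: countable1.
- move=> Y_piUC y oy; apply: (Y_piUC y).
  have [_ y_least] := least_cardP (local_pi_basis_ex y).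
  apply: card_le_trans (y_least _ (open_isolated_local_base oy).1) _.
  exact: countable1.
- exact: crowded_SHD.
Qed.

(** * Transfer between a space and its Pixley-Roy hyperspace *)

Section PixleyRoyTransfer.
Variable X : topologicalType.
Implicit Types F G : pixley_roy X.

Lemma pr_intervalxx F (U : set X) : [set` val F] `<=` U -> pr_interval F U F.
Proof. by split. Qed.

Lemma open_pr_interval F (U : set X) : open U -> open (pr_interval F U).
Proof.
move=> oU; apply/pr_openE; exists [set pr_interval F U]; last exact: bigcup_set1.
by move=> _ ->; exists F, U.
Qed.

(** A basic set around [F] may be taken with [F] itself as lower end, since raising the lower end to
    [F] only shrinks the interval. *)
Lemma open_pr_intervalP (W : set (pixley_roy X)) :
  open W <-> forall F, W F -> exists U,
    [/\ open U, [set` val F] `<=` U & pr_interval F U `<=` W].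
Proof.
split=> [/pr_openE[D D_base <-] F [V DV]|W_nbhs].
  have [E [U [oU VE]]] := D_base _ DV; subst V => -[EF FU].
  exists U; split=> // G [FG GU]; exists (pr_interval E U) => //.
  by split=> //; exact: subset_trans FG.
rewrite openE => F /W_nbhs[U [oU FU UW]]; rewrite /interior nbhsE.
exists (pr_interval F U) => //; split; first exact: open_pr_interval.
exact: pr_intervalxx.
Qed.

Lemma pixley_roy_p_space : p_space X -> p_space (pixley_roy X).
Proof.
move=> X_P W oW; apply/open_pr_intervalP => F WF.
have /choice[U UP] n : exists U, [/\ open U, [set` val F] `<=` U &
    pr_interval F U `<=` W n].
  by apply: (open_pr_intervalP _).1 => //; exact: WF.
exists (\bigcap_n U n); split.
- by apply: X_P => n; have [] := UP n.
- by move=> t Ft n _; have [_ + _] := UP n; apply.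
- move=> G [FG GU] n _; have [_ _] := UP n; apply; split=> // t /GU; exact.
Qed.

Lemma pixley_roy_accessible :
  accessible_space X -> accessible_space (pixley_roy X).
Proof.
move=> X_T1 F G FG; have [FsubG|FnsubG] := pselect ([set` val F] `<=` [set` val G]).
  have [g Gg Fg] : exists2 g, g \in val G & g \notin val F.
    apply: contrapT => nog; move/eqP: FG; apply; apply/val_inj/fsetP => t.
    apply/idP/idP => [/FsubG//|Gt].
    by apply: contrapT => /negP Ft; apply: nog; exists t.
  (* When [F] is strictly inside [G], the upper bound excludes [G] by omitting an extra point [g];
     otherwise the lower bound [F] alone excludes it. *)
  exists (pr_interval F (~` [set g])); split.
  - exact/open_pr_interval/accessible_open_setC1.
  - rewrite inE; apply: pr_intervalxx => t /= Ft tg.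
    by move: Fg; rewrite -tg Ft.
  - by rewrite inE => -[_ /(_ g Gg)]; apply.
exists (pr_interval F setT); split.
- exact/open_pr_interval/openT.
- by rewrite inE; exact: pr_intervalxx.
- by rewrite inE => -[].
Qed.

(** An isolated [x] isolates its singleton in the hyperspace. Conversely, an isolated [F] is a
    finite non-empty open subset of [X], and T1 isolates each of its points. *)
Lemma pixley_roy_crowded :
  accessible_space X -> crowded (pixley_roy X) <-> crowded X.
Proof.
move=> X_T1; split=> [PR_crowded x ox|X_crowded F].
  have x0 : [fset x]%fset != fset0 by apply/fset0Pn; exists x; rewrite inE.
  pose Fx : pixley_roy X := exist _ [fset x]%fset x0.
  apply: (PR_crowded Fx).
  suff <- : pr_interval Fx [set x] = [set Fx] by exact: open_pr_interval.
  apply/seteqP; split=> [G [FG GU]|_ ->]; last first.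
    by apply: pr_intervalxx => t /=; rewrite inE => /eqP.
  apply/val_inj/fsetP => t; apply/idP/idP => [/GU -> |]; last exact: FG.
  by rewrite inE.
move=> /open_pr_intervalP/(_ F erefl)[U [oU FU UF]].
have [x Fx] := fset0Pn _ (valP F).
(* Adding [u] to [F] stays within the interval from [F] to [U], which contains only [F]. *)
have U_F u : U u -> u \in val F.
  move=> Uu; have uF0 : (u |` val F)%fset != fset0.
    by apply/fset0Pn; exists u; rewrite fset1U1.
  have <- : (exist _ (u |` val F)%fset uF0 : pixley_roy X) = F.
    apply: UF; split=> t /= => [Ft|/fset1UP[->//|/FU//]].
    exact: fset1Ur.
  exact: fset1U1.
apply: (X_crowded x).
have oV : open (U `&` ~` ([set` val F] `\ x)).
  apply: openI => //; rewrite openC; apply: accessible_finite_set_closed.1 => //.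
  exact: finite_setD.
suff <- : U `&` ~` ([set` val F] `\ x) = [set x] by [].
apply/seteqP; split=> [t [/U_F Ft ntF]|_ ->]; last first.
  by split; [exact: FU|move=> [_ /(_ erefl)]].
by apply: contrapT => tx; exact: ntF.
Qed.

End PixleyRoyTransfer.

Theorem theorem11 (X : topologicalType)
    (X_T1 : accessible_space X) (X_regular : regular_space X)
    (X_P : p_space X) (X_two : exists x y : X, x <> y) :
  [<-> SHD (pixley_roy X);
       WSHD (pixley_roy X);
       OHD (pixley_roy X);
       UC (pixley_roy X);
       pi_UC (pixley_roy X);
       SHD X;
       WSHD X;
       OHD X;
       UC X;
       pi_UC X].
Proof.
have TX := T1_p_space_crowded_tfae X_T1 X_P.
have TF := T1_p_space_crowded_tfae (pixley_roy_accessible X_T1)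
  (pixley_roy_p_space X_P).
have FX := pixley_roy_crowded X_T1.
tfae.
- exact: (TF 0 1).1.
- exact: (TF 1 2).1.
- exact: (TF 2 3).1.
- exact: (TF 3 4).1.
(* The cycle passes between the hyperspace and [X] through crowdedness, entry 5 of both lists. *)
- by move=> /(TF 4 5).1/FX/(TX 5 0).1.
- exact: (TX 0 1).1.
- exact: (TX 1 2).1.
- exact: (TX 2 3).1.
- exact: (TX 3 4).1.
- by move=> /(TX 4 5).1/FX/(TF 5 0).1.
Qed.
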